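(* Let $h\geq 2$ and let $n,r$ be positive integers with $n>r\geq 2h$. If $A$ is an $S_h$-linear set in $\mathbb{F}_q^r$ with $n$ non-zero elements, then the $q$-linear code whose parity-check matrix is the $r\times n$ matrix having the $n$ non-zero elements of $A$ as columns is an $[n,t,d]$-linear code with $d\geq 2h+1$ and $n-r\leq t\leq n-2h$. Moreover, if $A$ is a maximal $S_h$-linear set, then $t=n-r$.
   Context: An $[n,t,d]$ $q$-linear code is a $t$-dimensional subspace $\mathcal{C}$ of $\mathbb{F}_q^n$ with minimum distance $d$ (minimum Hamming weight of a non-zero codeword). The code with parity-check matrix $H$ (an $r\times n$ matrix over $\mathbb{F}_q$) is $\{\boldsymbol{x}\in\mathbb{F}_q^n: H\boldsymbol{x}^T=\boldsymbol{0}\}$. For a non-empty subset $A$ of $\mathbb{F}_q^r$ and a positive integer $h\leq|A|$, an $h$-linear combination of $A$ is an expression $\lambda_1\boldsymbol{a}_1+\cdots+\lambda_h\boldsymbol{a}_h$ with $\lambda_i\in\mathbb{F}_q^*$ and $\boldsymbol{a}_1,\dots,\boldsymbol{a}_h$ distinct elements of $A$. $A$ is an $S_h$-linear set if all $h$-linear combinations of elements of $A$, omitting permutations of the summands, yield distinct elements of $\mathbb{F}_q^r$ (combinations differing only in the scalar attached to $\boldsymbol{0}$ being regarded as the same). An $S_h$-linear set $M$ is maximal if for every $S_h$-linear set $A$ with $M\subseteq A\subseteq\mathbb{F}_q^r$ one has $M=A$.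
   Formalization: For q = 2 the bound d ≥ 2h+1 is claimed only when 0 belongs to A, since it fails otherwise (e.g. A = {1100, 0100, 1000, 1110, 1101, 0011}, h = 2, r = 4 has d ≤ 3); all other conclusions are stated for every q as in the English. *)

(* Defs.v *)
From HB Require Import structures.
From mathcomp Require Import all_boot all_order all_algebra all_fingroup.

Set Implicit Arguments.
Unset Strict Implicit.
Unset Printing Implicit Defensive.

Import GRing.Theory.
Local Open Scope ring_scope.

Section LinearCodes.
Variables (F : finFieldType) (n : nat).

Definition hamming_weight (x : 'rV[F]_n) : nat := #|[set i | x 0 i != 0]|.

Definition is_min_distance (C : {vspace 'rV[F]_n}) (d : nat) : Prop :=
  (exists x, [/\ x \in C, x != 0 & hamming_weight x = d]) /\
  (forall x, x \in C -> x != 0 -> (d <= hamming_weight x)%N).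

Definition is_linear_code (C : {vspace 'rV[F]_n}) (t d : nat) : Prop :=
  \dim C = t /\ is_min_distance C d.

Definition parity_check_code (r : nat) (H : 'M[F]_(r, n)) :
    {vspace 'rV[F]_n} :=
  lker (linfun (mulmx H \o trmx)).

Lemma mem_parity_check_code r (H : 'M[F]_(r, n)) (x : 'rV[F]_n) :
  (x \in parity_check_code H) = (H *m x^T == 0).
Proof. by rewrite memv_ker lfunE. Qed.

End LinearCodes.

Section LinearSets.
Variables (F : finFieldType) (r : nat).
Implicit Types A M : {set 'cV[F]_r}.

(* The formal expression l_1 a_1 + ... + l_h a_h. *)
Definition is_lincomb (h : nat) A (l : 'I_h -> F) (a : 'I_h -> 'cV[F]_r) :
    Prop :=
  [/\ forall i, l i != 0, injective a & forall i, a i \in A].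

(* Equality of expressions up to a permutation of the summands and up to the
   scalar attached to the zero vector. *)
Definition same_lincomb (h : nat) (l : 'I_h -> F) (a : 'I_h -> 'cV[F]_r)
    (l' : 'I_h -> F) (a' : 'I_h -> 'cV[F]_r) : Prop :=
  exists s : 'S_h,
    forall i, a' i = a (s i) /\ (a' i != 0 -> l' i = l (s i)).

Definition S_linear (h : nat) A : Prop :=
  [/\ (0 < h)%N, (h <= #|A|)%N &
   forall l a l' a', is_lincomb (h := h) A l a -> is_lincomb A l' a' ->
     \sum_i l i *: a i = \sum_i l' i *: a' i -> same_lincomb l a l' a'].

Definition maximal_S_linear (h : nat) M : Prop :=
  S_linear h M /\ forall A, S_linear h A -> M \subset A -> M = A.

(* The columns of H are the nonzero elements of A, each occurring once, in an
   arbitrary order. *)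
Definition has_nonzero_columns (n : nat) (H : 'M[F]_(r, n)) A : Prop :=
  injective (fun j => col j H) /\ [set col j H | j : 'I_n] = A :\ 0.

End LinearSets.

(* Over the field with two elements, an S_h-linear set that does not contain 0
   may yield a code of minimum distance smaller than 2h+1: the six columns
   1100, 0100, 1000, 1110, 1101, 0011 form an S_2-linear set, and the first
   three of them add up to 0. *)
Definition binary_entry (j i : nat) : bool :=
  nth false (nth [::]
    [:: [:: true; true; false; false]; [:: false; true; false; false];
        [:: true; false; false; false]; [:: true; true; true; false];
        [:: true; true; false; true]; [:: false; false; true; true]] j) i.

Definition binary_matrix : 'M['F_2]_(4, 6) :=
  \matrix_(i, j) (binary_entry j i)%:R.

Definition binary_set : {set 'cV['F_2]_4} :=
  [set col j binary_matrix | j : 'I_6].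

Fact F2_addb (b c : bool) : b%:R + c%:R = (b (+) c)%:R :> 'F_2.
Proof. by apply/val_inj; case: b; case: c. Qed.

Fact F2_bool_inj (b c : bool) : b%:R = c%:R :> 'F_2 -> b = c.
Proof. by case: b; case: c => // /(congr1 val). Qed.

Fact F2_neq0 (x : 'F_2) : x != 0 -> x = 1.
Proof. by case: x => [[|[|m]] lt_m] // _; apply/val_inj. Qed.

Fact ord_forall (m : nat) (P : pred nat) :
  all P (iota 0 m) -> forall j : 'I_m, P j.
Proof. by move=> /allP aP j; apply: aP; rewrite mem_iota /= add0n. Qed.

Fact binary_entry_eq (j k : 'I_6) :
  (forall i : 'I_4, binary_entry j i = binary_entry k i) -> j = k.
Proof.
move=> e; apply/val_inj/eqP; move: j k e.
have chk : all (fun j => all (fun k =>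
    all (fun i => binary_entry j i == binary_entry k i) (iota 0 4) ==> (j == k))
  (iota 0 6)) (iota 0 6) by vm_compute.
move=> j k e; apply: (implyP (ord_forall (ord_forall chk j) k)).
by apply/allP => i; rewrite mem_iota => /= lt_i; apply/eqP/(e (Ordinal lt_i)).
Qed.

Fact binary_entry_sum (j k j' k' : 'I_6) : j != k -> j' != k' ->
  (forall i : 'I_4, binary_entry j i (+) binary_entry k i =
                    binary_entry j' i (+) binary_entry k' i) ->
  (j' == j) && (k' == k) || (j' == k) && (k' == j).
Proof.
have chk : all (fun j => all (fun k => all (fun j' => all (fun k' =>
    (j != k) ==> (j' != k') ==>
    all (fun i => binary_entry j i (+) binary_entry k i ==
                  binary_entry j' i (+) binary_entry k' i) (iota 0 4) ==>
    ((j' == j) && (k' == k) || (j' == k) && (k' == j)))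
  (iota 0 6)) (iota 0 6)) (iota 0 6)) (iota 0 6) by vm_compute.
move=> njk njk' e.
have /implyP/(_ njk)/implyP/(_ njk')/implyP :=
  ord_forall (ord_forall (ord_forall (ord_forall chk j) k) j') k'.
apply.
by apply/allP => i; rewrite mem_iota => /= lt_i; apply/eqP/(e (Ordinal lt_i)).
Qed.

Fact binary_col_inj : injective (fun j => col j binary_matrix).
Proof.
move=> j k /= e; apply: binary_entry_eq => i; apply: F2_bool_inj.
by move/matrixP: e => /(_ i 0); rewrite !mxE.
Qed.

Fact binary_set_neq0 : 0 \notin binary_set.
Proof.
have chk : all (fun j => has (binary_entry j) (iota 0 4)) (iota 0 6).
  by vm_compute.
apply/negP => /imsetP[j _ e].
have /hasP[i] := ord_forall chk j; rewrite mem_iota => /= lt_i b1.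
by move/matrixP: e => /(_ (Ordinal lt_i) 0); rewrite !mxE b1 => /(congr1 val).
Qed.

Lemma binary_S_linear : S_linear 2 binary_set.
Proof.
split=> //; first by rewrite (card_imset _ binary_col_inj) card_ord.
move=> l a l' a' [l0 ia aA] [l0' ia' aA'].
have l1 i : l i = 1 by apply/F2_neq0/l0.
have l1' i : l' i = 1 by apply/F2_neq0/l0'.
rewrite !big_ord_recl !big_ord0 !addr0 !l1 !l1' !scale1r.
set o := lift ord0 ord0.
have /imsetP[j _ ej] := aA ord0; have /imsetP[k _ ek] := aA o.
have /imsetP[j' _ ej'] := aA' ord0; have /imsetP[k' _ ek'] := aA' o.
have njk : j != k.
  by apply/eqP => e; have /(congr1 val) : ord0 = o by apply: ia; rewrite ej ek e.
have njk' : j' != k'.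
  apply/eqP => e.
  by have /(congr1 val) : ord0 = o by apply: ia'; rewrite ej' ek' e.
rewrite ej ek ej' ek' => /matrixP e.
have eb (i : 'I_4) : binary_entry j i (+) binary_entry k i =
                     binary_entry j' i (+) binary_entry k' i.
  by apply: F2_bool_inj; have := e i 0; rewrite !mxE !F2_addb.
have oP (i : 'I_2) : i = ord0 \/ i = o.
  by case: i => [[|[|m]] lt_m] //; [left | right]; apply/val_inj.
case/orP: (binary_entry_sum njk njk' eb) => /andP[/eqP ejj /eqP ekk].
  exists 1%g => i; rewrite perm1 l1 l1'; split=> //.
  by case: (oP i) => ->; rewrite ?ej' ?ek' ?ej ?ek ?ejj ?ekk.
exists (tperm ord0 o) => i; rewrite l1 l1'; split=> //.
by case: (oP i) => ->; rewrite ?tpermL ?tpermR ?ej' ?ek' ?ej ?ek ?ejj ?ekk.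
Qed.

Lemma binary_counterexample :
  [/\ S_linear 2 binary_set, #|binary_set :\ 0| = 6%N,
      has_nonzero_columns binary_matrix binary_set &
      forall d, is_min_distance (parity_check_code binary_matrix) d ->
        (d <= 3)%N].
Proof.
have D0 : binary_set :\ 0 = binary_set.
  by apply/setP => x; rewrite !inE; case: eqP => // ->;
     rewrite (negbTE binary_set_neq0).
split; first exact: binary_S_linear.
- by rewrite D0 (card_imset _ binary_col_inj) card_ord.
- by split; [exact: binary_col_inj | rewrite D0].
move=> d [_ /(_ (\row_j (j < 3)%N%:R))].
have -> : hamming_weight (\row_(j < 6) (j < 3)%N%:R : 'rV['F_2]_6) = 3%N.
  rewrite /hamming_weight -sum1_card big_mkcond !big_ord_recl big_ord0.
  by rewrite !inE !mxE.
apply; last first.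
  by apply/eqP => /matrixP/(_ 0 0); rewrite !mxE => /(congr1 val).
rewrite mem_parity_check_code; apply/eqP/matrixP => i k.
rewrite !mxE !big_ord_recl big_ord0 !mxE /= !mulr0 !mulr1 !addr0.
by rewrite !F2_addb; case: i => [[|[|[|[|m]]]] lt_m] //=; apply/val_inj.
Qed.

(* Main.v *)
Require Import Defs.
From HB Require Import structures.
From mathcomp Require Import all_boot all_order all_algebra all_fingroup.
From mathcomp Require Import zify.

(** An [h]-linear combination is encoded by its coefficient function
    [V -> F], so that a codeword is a relation [csum z = 0] with support among
    the nonzero elements of [A].  A relation of even weight [2k <= 2h] splits
    into two disjoint [k]-combinations with equal sums, and padding both with
    the same [h - k] elements contradicts the [S_h] property.  Odd weights are
    reduced to this by adding the summand [0], or, if [|F| > 2], by letting both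
    halves share one element with different scalars.  The upper bound on [t] is
    then the Singleton bound; over the field with two elements and when
    [0 \notin A], it is applied to the even-weight subcode, whose nonzero words
    have weight at least [2h + 2].  If [t > n - r], the columns span a proper
    subspace, and adding to [A] a vector outside of it preserves the [S_h]
    property, so [A] is not maximal. *)

Set Implicit Arguments.
Unset Strict Implicit.
Unset Printing Implicit Defensive.

Import GRing.Theory.
Local Open Scope ring_scope.

Lemma exists_subset_card (T : finType) (B : {set T}) (k : nat) :
  (k <= #|B|)%N -> exists2 C : {set T}, C \subset B & #|C| = k.
Proof.
elim: k => [|k IHk] le_k; first by exists set0; rewrite ?sub0set ?cards0.
have [C sCB cC] := IHk (ltnW le_k).
have : (0 < #|B :\: C|)%N.
  by rewrite cardsD (setIidPr sCB) cC subn_gt0.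
case/card_gt0P => x; rewrite inE => /andP[xC xB].
exists (x |: C); first by rewrite subUset sub1set xB.
by rewrite cardsU1 xC cC.
Qed.

(** * Linear combinations as coefficient functions, and the uniqueness of their sums *)

Section CoefficientFunctions.
Variables (F : finFieldType) (r : nat).
Local Notation V := 'cV[F]_r.
Implicit Types (A : {set V}) (u v z : V -> F).

Definition csupp u : {set V} := [set x | u x != 0].
Definition csum u : V := \sum_x u x *: x.

Lemma csuppP u x : reflect (u x = 0) (x \notin csupp u).
Proof. by rewrite inE negbK; apply: eqP. Qed.

Lemma csumD u v : csum (fun x => u x + v x) = csum u + csum v.
Proof. by rewrite -big_split; apply: eq_bigr => x _; rewrite scalerDl. Qed.

(** The comparison leaves out [0], whose scalar does not affect the sum. With no condition on
    [#|A|], the notion can be passed from [h] down to smaller sizes. *)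
Definition unique_sums (h : nat) A : Prop :=
  forall u v, csupp u \subset A -> csupp v \subset A ->
    #|csupp u| = h -> #|csupp v| = h -> csum u = csum v ->
    {in predC1 0, u =1 v}.

Section Pushforward.
Variables (I : finType) (a : I -> V) (l : I -> F).

Definition coef_of (x : V) : F := \sum_(i | a i == x) l i.

Lemma csum_coef_of : csum coef_of = \sum_i l i *: a i.
Proof.
rewrite (partition_big a predT) //=; apply: eq_bigr => x _.
by rewrite scaler_suml; apply: eq_bigr => i /eqP->.
Qed.

Hypothesis a_inj : injective a.

Lemma coef_ofE i : coef_of (a i) = l i.
Proof.
rewrite /coef_of (bigD1 i) //= big1 ?addr0 // => j /andP[/eqP/a_inj->].
by rewrite eqxx.
Qed.

Lemma csupp_coef_of : csupp coef_of = a @: [set i | l i != 0].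
Proof.
apply/setP => x; apply/idP/imsetP => [|[i]]; rewrite inE; last first.
  by move=> li ->; rewrite inE coef_ofE.
move=> nz; case: (pickP (fun i => a i == x)) => [i /eqP ei|no]; last first.
  by move: nz; rewrite /coef_of big_pred0 // eqxx.
by exists i => //; rewrite inE -coef_ofE ei.
Qed.

Lemma card_csupp_coef_of : #|csupp coef_of| = #|[set i | l i != 0]|.
Proof. by rewrite csupp_coef_of card_imset. Qed.

End Pushforward.

Lemma csupp_enum u h : #|csupp u| = h ->
  exists a : 'I_h -> V, [/\ injective a, forall i, a i \in csupp u,
    forall x, x \in csupp u -> exists i, x = a i &
    \sum_i u (a i) *: a i = csum u].
Proof.
move=> eh; rewrite -{h}eh.
exists (fun i => enum_val i); split.
- exact: enum_val_inj.
- by move=> i; apply: enum_valP.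
- by move=> x xu; exists (enum_rank_in xu x); rewrite enum_rankK_in.
rewrite /csum (bigID (mem (csupp u))) /= [X in _ = _ + X]big1 => [|x /csuppP->].
  by rewrite addr0 [RHS]big_enum_val.
by rewrite scale0r.
Qed.

Lemma S_linear_unique_sums h A : S_linear h A -> unique_sums h A.
Proof.
case=> _ _ SA u v uA vA cu cv e x x0.
have [a [ia au aE sa]] := csupp_enum cu.
have [b [ib bv bE sb]] := csupp_enum cv.
have [|||s sP] := SA (u \o a) a (v \o b) b.
- split=> // i; first by have := au i; rewrite inE.
  exact: (subsetP uA).
- split=> // i; first by have := bv i; rewrite inE.
  exact: (subsetP vA).
- by rewrite /= sa sb.
have [xv|xv] := boolP (x \in csupp v).
  have [i xi] := bE x xv; have [e1 e2] := sP i.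
  by rewrite xi in x0 *; rewrite [RHS](e2 x0) /= e1.
(* Outside the support of [v]: a point [a j] of the support of [u] equals [b (s^-1 j)], which lies
   in the support of [v]. *)
rewrite (csuppP _ _ xv); apply/csuppP; apply: contra xv => /aE[j ->].
by have [e1 _] := sP (s^-1 j)%g; rewrite permKV in e1; rewrite -e1.
Qed.

(** The coefficient functions agree off [0], so their supports do too; since both have [h] elements,
    they also agree on whether [0] occurs. Both families then enumerate one set, and the permutation
    matches the enumerations. *)
Lemma unique_sums_S_linear h A : (0 < h)%N -> (h <= #|A|)%N ->
  unique_sums h A -> S_linear h A.
Proof.
move=> h0 hA UA; split=> // l a l' b [l0 ia aA] [l0' ib bA] e.
have full (k : 'I_h -> F) : (forall i, k i != 0) -> [set i | k i != 0] = setT.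
  by move=> k0; apply/setP => i; rewrite !inE k0.
have su := csupp_coef_of l ia; have sv := csupp_coef_of l' ib.
rewrite !full // in su sv.
have cu : #|csupp (coef_of a l)| = h.
  by rewrite su card_imset // cardsT card_ord.
have cv : #|csupp (coef_of b l')| = h.
  by rewrite sv card_imset // cardsT card_ord.
have E : {in predC1 0, coef_of a l =1 coef_of b l'}.
  apply: UA => //; rewrite ?csum_coef_of //.
  - by rewrite su; apply/subsetP => x /imsetP[i _ ->].
  - by rewrite sv; apply/subsetP => x /imsetP[i _ ->].
have eD : csupp (coef_of a l) :\ 0 = csupp (coef_of b l') :\ 0.
  apply/setP => x; rewrite !in_setD1; case: (eqVneq x 0) => //= x0.
  by rewrite !inE E.
have e0 : (0 \in csupp (coef_of a l)) = (0 \in csupp (coef_of b l')).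
  have := cardsD1 0 (csupp (coef_of a l)).
  have := cardsD1 0 (csupp (coef_of b l')).
  rewrite eD cu cv => e1 e2; have /addIn := etrans (esym e2) e1.
  by do 2!case: (0 \in _).
have eS : csupp (coef_of b l') = csupp (coef_of a l).
  apply/setP => x; case: (eqVneq x 0) => [->//|x0].
  by move/setP: eD => /(_ x); rewrite !in_setD1 x0.
have ex i : exists j, b i == a j.
  have : b i \in csupp (coef_of a l) by rewrite -eS sv imset_f.
  by rewrite su => /imsetP[j _ ->]; exists j.
pose s i := xchoose (ex i).
have sE i : b i = a (s i) by apply/eqP/(xchooseP (ex i)).
have s_inj : injective s by move=> i j eij; apply: ib; rewrite !sE eij.
exists (perm s_inj) => i; rewrite permE; split=> // bi0.
by rewrite -(coef_ofE l' ib) -(coef_ofE l ia) -E // -sE.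
Qed.

(* Pad both combinations with the same h - k elements, off both supports. *)
Lemma unique_sums_leq h k A : (k <= h)%N -> (k + h <= #|A|)%N ->
  unique_sums h A -> unique_sums k A.
Proof.
move=> kh khA UA u v uA vA cu cv e.
pose B := A :\: (csupp u :|: csupp v).
have [S sSB cS] : exists2 S : {set V}, S \subset B & #|S| = (h - k)%N.
  apply: exists_subset_card.
  (* The supports cover at most [2k] elements of [A], and [k + h <= #|A|] leaves at least [h - k]
     others. *)
  have := cardsID (csupp u :|: csupp v) A.
  have := subset_leq_card (subsetIr A (csupp u :|: csupp v)).
  have := cardsUI (csupp u) (csupp v).
  rewrite -/B; lia.
pose p x : F := (x \in S)%:R.
have off x : x \in S -> [/\ u x = 0, v x = 0 & x \in A].
  move=> xS; have := subsetP sSB x xS; rewrite !inE negb_or !negbK.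
  by case/andP=> /andP[/eqP-> /eqP->].
have padP w : csupp w \subset A -> #|csupp w| = k ->
    (forall x, x \in S -> w x = 0) ->
    csupp (fun x => w x + p x) \subset A /\
    #|csupp (fun x => w x + p x)| = h.
  move=> wA cw w0.
  have -> : csupp (fun x => w x + p x) = csupp w :|: S.
    apply/setP => x; rewrite !inE /p; case: (boolP (x \in S)) => xS.
      by rewrite w0 // add0r oner_eq0 orbT.
    by rewrite addr0 orbF.
  split.
    by rewrite subUset wA; apply/subsetP => x /off[].
  rewrite cardsU cw cS; have -> : csupp w :&: S = set0.
    apply/setP => x; rewrite !inE; apply/negP => /andP[wx xS].
    by rewrite w0 ?eqxx in wx.
  by rewrite cards0 subn0 subnKC.
have [|u1 u2] := padP u uA cu; first by move=> x /off[].
have [|v1 v2] := padP v vA cv; first by move=> x /off[].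
move=> x x0; apply: (@addIr _ (p x)).
by apply: (UA _ _ u1 v1 u2 v2) => //; rewrite !csumD e.
Qed.

(** * Relations of small weight *)

Lemma csupp_restr z (B : {set V}) : B \subset csupp z ->
  csupp (fun x => if x \in B then z x else 0) = B.
Proof.
move=> sB; apply/setP => x; rewrite inE.
by case: ifP => [/(subsetP sB)|_]; rewrite ?inE ?eqxx.
Qed.

Lemma csuppN u : csupp (fun x => - u x) = csupp u.
Proof. by apply/setP => x; rewrite !inE oppr_eq0. Qed.

Lemma csumN u : csum (fun x => - u x) = - csum u.
Proof. by rewrite -sumrN; apply: eq_bigr => x _; rewrite scaleNr. Qed.

(** Cutting the support into halves gives [z = u + w], where [u] and [-w] have equal sums and hence
    agree off [0]. The support of [z] may contain [0], which lets an odd relation be completed by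
    the summand [0]. *)
Lemma even_relation_trivial k A z : unique_sums k A -> csupp z \subset A ->
  #|csupp z| = (2 * k)%N -> csum z = 0 -> {in predC1 0, z =1 fun=> 0}.
Proof.
move=> UA zA cz z0.
have [|B sB cB] := @exists_subset_card _ (csupp z) k; first by rewrite cz; lia.
pose B' := csupp z :\: B.
have sB' : B' \subset csupp z by apply: subsetDl.
have cB' : #|B'| = k by rewrite cardsD (setIidPr sB) cz cB; lia.
pose u x := if x \in B then z x else 0.
pose w x := if x \in B' then z x else 0.
have zE x : z x = u x + w x.
  rewrite /u /w in_setD; case: (boolP (x \in B)) => xB /=;
    rewrite ?addr0 ?add0r //.
  by case: (boolP (x \in csupp z)) => // /csuppP.
have E : {in predC1 0, u =1 fun x => - w x}.
  apply: UA; rewrite ?csuppN ?csupp_restr //; try exact: subset_trans zA.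
  rewrite csumN; apply/eqP; rewrite -addr_eq0 -csumD -z0; apply/eqP.
  by apply: eq_bigr => x _; rewrite zE.
by move=> x x0; rewrite zE E // addNr.
Qed.

(* Both halves of an odd relation get x0, whose coefficient z x0 is written as
   a difference of two nonzero scalars y and y - z x0. *)
Lemma odd_relation_trivial k A z : #|F| != 2%N -> unique_sums k.+1 A ->
  csupp z \subset A :\ 0 -> #|csupp z| = (2 * k).+1 -> csum z <> 0.
Proof.
move=> F2 UA zA cz z0.
have [x0 x0z] : exists x0, x0 \in csupp z by apply/card_gt0P; rewrite cz.
have := subsetP zA x0 x0z; rewrite !inE => /andP[nx0 x0A].
have zx0 : z x0 != 0 by rewrite inE in x0z.
(* Otherwise [F] would consist of [0] and [z x0] only. *)
have [y y0 yz] : exists2 y : F, y != 0 & y != z x0.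
  case: (pickP (fun y : F => (y != 0) && (y != z x0))) => [y /andP[]|no].
    by exists y.
  case/eqP: F2; rewrite -cardsT.
  have -> : [set: F] = [set 0; z x0].
    by apply/setP => y; rewrite !inE; move/negbT: (no y); rewrite negb_and !negbK.
  by rewrite cards2 eq_sym zx0.
have [|B sB cB] := @exists_subset_card _ (csupp z :\ x0) k.
  by have := cardsD1 x0 (csupp z); rewrite x0z cz; lia.
pose B' := (csupp z :\ x0) :\: B.
have cB' : #|B'| = k.
  rewrite cardsD (setIidPr sB) cB.
  by have := cardsD1 x0 (csupp z); rewrite x0z cz; lia.
have x0B : x0 \notin B.
  by apply/negP => /(subsetP sB); rewrite !inE eqxx.
have x0B' : x0 \notin B' by rewrite !inE eqxx andbF.
have sBz : B \subset csupp z by apply: subset_trans sB _; apply: subsetDl.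
have sB'z : B' \subset csupp z.
  by apply: subset_trans (subsetDl _ _) _; apply: subsetDl.
pose u x := if x == x0 then y else if x \in B then z x else 0.
pose w x := if x == x0 then y - z x0 else if x \in B' then - z x else 0.
have zE x : u x = w x + z x.
  rewrite /u /w; case: eqP => [->|/eqP nx]; first by rewrite subrK.
  rewrite in_setD in_setD1 nx /=; case: (x \in B) => /=; first by rewrite add0r.
  case: (boolP (x \in csupp z)) => [_|/csuppP->]; first by rewrite addNr.
  by rewrite addr0.
have su : csupp u = x0 |: B.
  apply/setP => x; rewrite !inE /u; case: (x =P x0) => //= _.
  by case: ifP => [/(subsetP sBz)|_]; rewrite ?inE ?eqxx.
have sw : csupp w = x0 |: B'.
  apply/setP => x; rewrite inE in_setU1 /w; case: (x =P x0) => [_|_].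
    by rewrite subr_eq0.
  by case: ifP => [/(subsetP sB'z)|_]; rewrite ?inE ?oppr_eq0 ?eqxx.
have zA' : csupp z \subset A by apply: subset_trans zA _; apply: subsetDl.
have E : {in predC1 0, u =1 w}.
  apply: UA.
  - by rewrite su subUset sub1set x0A (subset_trans sBz).
  - by rewrite sw subUset sub1set x0A (subset_trans sB'z).
  - by rewrite su cardsU1 x0B cB.
  - by rewrite sw cardsU1 x0B' cB'.
  rewrite -[RHS]addr0 -z0 -csumD.
  by apply: eq_bigr => x _; rewrite zE.
have /eqP := E x0 nx0.
by rewrite zE -subr_eq0 addrAC subrr add0r (negbTE zx0).
Qed.

(** A relation of weight at most [2h] is refuted according to parity. An odd weight [2k + 1] is less
    than [2h], so [k + 1 <= h] and sums of size [k + 1] are still unique. *)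
Lemma relation_weight h A z : unique_sums h A -> (2 * h <= #|A|)%N ->
    (#|F| = 2%N -> 0 \in A) ->
  csupp z \subset A :\ 0 -> csum z = 0 -> (0 < #|csupp z|)%N ->
  (2 * h < #|csupp z|)%N.
Proof.
move=> UA hA F2 zA z0 zn; rewrite ltnNge; apply/negP => le_zh.
have zA' : csupp z \subset A by apply: subset_trans zA _; apply: subsetDl.
have U k : (k <= h)%N -> unique_sums k A.
  by move=> kh; apply: unique_sums_leq UA => //; lia.
have [x xz] : exists x, x \in csupp z by apply/card_gt0P.
have := subsetP zA x xz; rewrite in_setD1 => /andP[nx xA].
pose k := #|csupp z|./2; have ck := odd_double_half #|csupp z|.
rewrite -/k in ck; case: (boolP (odd #|csupp z|)) ck => [|] odd_z ck; last first.
  move: xz; apply/negP/csuppP; apply: (even_relation_trivial (U k _)) => //; lia.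
have [F2'|F2'] := eqVneq #|F| 2; last first.
  by apply: (odd_relation_trivial F2' (U k.+1 _) zA) => //; lia.
have A0 := F2 F2'.
have z00 : 0 \notin csupp z.
  by apply/negP => /(subsetP zA); rewrite !inE eqxx.
(* Coefficient [1] at [0] raises the weight to [2(k + 1)] but keeps both the sum and the value at
   [x]. *)
pose w y := z y + (y == 0)%:R.
have sw : csupp w = 0 |: csupp z.
  apply/setP => y; rewrite !inE /w; case: (y =P 0) => [->|_] /=; last by rewrite addr0.
  by rewrite (csuppP _ _ z00) add0r oner_eq0.
have : w x = 0.
  apply: (even_relation_trivial (U k.+1 _)) => //; first by lia.
  - by rewrite sw subUset sub1set A0.
  - by rewrite sw cardsU1 z00; lia.
  rewrite csumD z0 add0r /csum (bigD1 0) //= scaler0 add0r big1 // => y.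
  by move=> /negbTE->; rewrite scale0r.
by move/eqP; rewrite /w (negbTE nx) addr0; rewrite inE in xz; rewrite (negbTE xz).
Qed.

(** Modulo [W] only the term in [v] survives, so equal sums have equal coefficients at [v]. Deleting
    that term leaves combinations of [A], both of size [h] or both of size [h - 1]. *)
Lemma unique_sums_adjoin h A (W : {vspace V}) (v : V) :
    unique_sums h A -> (2 * h <= #|A|)%N -> {subset A <= W} -> v \notin W ->
  unique_sums h (v |: A).
Proof.
move=> UA hA AW vW u w uA wA cu cw e.
have vA : v \notin A by apply: contra vW; apply: AW.
have v0 : v != 0 by apply: contraNneq vW => ->; rewrite mem0v.
pose cut z x : F := if x == v then 0 else z x.
have scut z : csupp (cut z) = csupp z :\ v.
  by apply/setP => x; rewrite !inE /cut; case: (x == v); rewrite ?eqxx.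
have cutA z : csupp z \subset v |: A -> csupp (cut z) \subset A.
  by rewrite scut subDset.
have ecut z : csum z = z v *: v + csum (cut z).
  rewrite /csum (bigD1 v) //= [in RHS](bigD1 v) //=; rewrite [cut z v]/cut eqxx scale0r add0r.
  by congr (_ + _); apply: eq_bigr => x /negbTE nx; rewrite /cut nx.
have cutW z : csupp z \subset v |: A -> csum (cut z) \in W.
  move=> zA; apply: memv_suml => x _; case: (boolP (x \in csupp (cut z))).
    by move/(subsetP (cutA z zA))/AW => xW; apply: memvZ.
  by move/csuppP->; rewrite scale0r mem0v.
(* If the coefficients differed, dividing by their difference would put [v] in [W]. *)
have uv : u v = w v.
  apply/eqP; rewrite -subr_eq0; apply: contraNT vW => d0.
  rewrite -[v](scalerK d0) memvZ // scalerBl.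
  have -> : u v *: v - w v *: v = csum (cut w) - csum (cut u).
    by apply/eqP; rewrite subr_eq addrAC eq_sym subr_eq addrC -!ecut e.
  by rewrite memvB ?cutW.
have ec : csum (cut u) = csum (cut w).
  by apply: (@addrI _ (u v *: v)); rewrite -ecut uv -ecut.
have E : {in predC1 0, cut u =1 cut w}.
  have cc z : #|csupp z| = h -> #|csupp (cut z)| = (h - (z v != 0)%R)%N.
    by rewrite scut => <-; rewrite (cardsD1 v (csupp z)) inE addKn.
  apply: (@unique_sums_leq h (h - (u v != 0)%R)%N A) => //; try exact: cutA.
  - by rewrite leq_subr.
  - by apply: leq_trans hA; rewrite mul2n -addnn leq_add2r leq_subr.
  - exact: cc.
  by rewrite uv; apply: cc.
move=> x x0; have := E x x0; rewrite /cut; by case: eqP => [->|].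
Qed.

End CoefficientFunctions.

(** Rank-nullity on [C]: the image of a linear form has dimension at most one. *)
Lemma dim_cap_lker_form (K : fieldType) (vT : vectType K) (C : {vspace vT})
    (g : 'Hom(vT, K^o)) :
  (\dim C <= (\dim (C :&: lker g)).+1)%N.
Proof.
have := limg_ker_dim g C; have := dimvS (subvf (g @: C)).
by rewrite dimvf /dim /=; lia.
Qed.

(** * The Singleton bound, minimum distance, and parity of binary weights *)

Section Codes.
Variables (F : finFieldType) (n : nat).
Implicit Types (C : {vspace 'rV[F]_n}) (x : 'rV[F]_n).

(* The words supported on the first m coordinates form an m-dimensional space
   that meets C trivially. *)
Lemma singleton_bound C m : (m <= n)%N ->
  (forall x, x \in C -> (hamming_weight x <= m)%N -> x = 0) ->
  (\dim C + m <= n)%N.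
Proof.
move=> le_mn Cm.
(* Multiplication by [pid_mx m] appends [n - m] zero coordinates. *)
pose f : 'Hom('rV[F]_m, 'rV[F]_n) := linfun (mulmxr (pid_mx m)).
have fK v : f v *m (pid_mx m : 'M_(n, m)) = v.
  by rewrite lfunE /= -mulmxA pid_mx_id // pid_mx_1 mulmx1.
have kf : lker f == 0%VS.
  by apply/lker0P => v w e; rewrite -[v]fK e fK.
have df : \dim (limg f) = m.
  by rewrite limg_dim_eq ?dimvf /dim /= ?mul1n // (eqP kf) capv0.
have wf v : (hamming_weight (f v) <= m)%N.
  rewrite -[X in (_ <= X)%N]card_ord -cardsT.
  apply: leq_trans (leq_imset_card (widen_ord le_mn) _).
  apply: subset_leq_card; apply/subsetP => j; rewrite inE lfunE /= mxE => nz.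
  have [lt_jm|le_mj] := ltnP j m.
    by apply/imsetP; exists (Ordinal lt_jm) => //; apply: val_inj.
  case/eqP: nz; rewrite big1 // => i _; rewrite mxE.
  by rewrite (ltn_eqF (leq_trans (ltn_ord i) le_mj)) mulr0.
have dis : (C :&: limg f = 0)%VS.
  apply/eqP; rewrite -subv0; apply/subvP => x; rewrite memv_cap => /andP[xC].
  by case/memv_imgP => v _ xv; rewrite memv0 (Cm x xC) // xv.
have := dimvS (subvf (C + limg f)).
by rewrite dimv_disjoint_sum // df dimvf /dim /= mul1n.
Qed.

Lemma min_distance_exists C : C != 0%VS -> exists d, is_min_distance C d.
Proof.
move=> C0; have P0 : (vpick C \in C) && (vpick C != 0).
  by rewrite memv_pick vpick0.
exists (hamming_weight [arg min_(x < vpick C | (x \in C) && (x != 0))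
  hamming_weight x]).
case: arg_minnP => // x /andP[xC x0] xmin; split; first by exists x.
by move=> y yC y0; apply: xmin; rewrite yC.
Qed.

(** Every nonzero coordinate is [1], so the coordinate sum is the image of the weight in [F], where
    [1 + 1 = 0]. *)
Lemma binary_weight_even x : #|F| = 2%N -> \sum_i x 0 i = 0 ->
  ~~ odd (hamming_weight x).
Proof.
move=> F2 s0.
have F01 (y : F) : y != 0 -> y = 1.
  move=> y0; apply/eqP; apply: contra_eqT F2 => y1.
  have : uniq [:: 0; 1; y].
    by rewrite /= !inE negb_or ![_ == y]eq_sym y0 y1 eq_sym oner_eq0.
  by move/card_uniqP => /= c3; have := max_card (mem [:: 0; 1; y]);
    rewrite c3 neq_ltn => ->; rewrite orbT.
have two0 : 1 + 1 = 0 :> F.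
  apply/eqP; apply/negPn/negP => /F01 /eqP.
  by rewrite -subr_eq0 addrK oner_eq0.
have : (hamming_weight x)%:R = 0 :> F.
  rewrite -s0 /hamming_weight -sum1_card natr_sum big_mkcond /=.
  apply: eq_bigr => i _; rewrite inE; case: eqP => [->//|/eqP/F01->//].
rewrite -[X in X%:R]odd_double_half natrD -muln2 natrM mulrC.
rewrite [X in _ + X](_ : _ = 0) ?addr0; last by rewrite mulr2n two0 mul0r.
by case: odd => // /eqP; rewrite oner_eq0.
Qed.

End Codes.

(* The proviso on the distance bound concerns only the field with two elements;
   without it the bound fails, see binary_counterexample. *)
Theorem theorem3p16 (F : finFieldType) (h n r : nat)
    (h_ge2 : (2 <= h)%N) (n_gt0 : (0 < n)%N) (r_gt0 : (0 < r)%N)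
    (r_lt_n : (r < n)%N) (r_ge_2h : (2 * h <= r)%N)
    (A : {set 'cV[F]_r}) (A_S_linear : S_linear h A)
    (A_card : #|A :\ 0| = n)
    (H : 'M[F]_(r, n)) (H_columns : has_nonzero_columns H A) :
  exists t d : nat,
    [/\ is_linear_code (parity_check_code H) t d,
        (#|F| = 2%N -> 0 \in A) -> (2 * h + 1 <= d)%N,
        (n - r <= t)%N /\ (t <= n - 2 * h)%N &
        maximal_S_linear h A -> t = (n - r)%N].
Proof.
have [h_gt0 hA _] := A_S_linear.
have UA := S_linear_unique_sums A_S_linear.
have [Hinj HA] := H_columns.
set C := parity_check_code H.
(* The kernel of [f] is [C], and its image is the span of the columns of [H]. *)
pose f : 'Hom('rV[F]_n, 'cV[F]_r) := linfun (mulmx H \o trmx).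
have nA : (n <= #|A|)%N by rewrite -A_card subset_leq_card // subsetDl.
(* As the columns are distinct and nonzero, [z] turns codewords into relations on [A :\ 0] of the
   same weight. *)
pose z (x : 'rV[F]_n) := coef_of (fun j => col j H) (x 0).
have csum_z x : csum (z x) = H *m x^T.
  rewrite csum_coef_of; apply/colP => i; rewrite mxE summxE.
  by apply: eq_bigr => j _; rewrite !mxE mulrC.
have card_z x : #|csupp (z x)| = hamming_weight x by apply: card_csupp_coef_of.
have supp_z x : csupp (z x) \subset A :\ 0.
  rewrite csupp_coef_of // -HA; apply/subsetP => y /imsetP[j _ ->].
  exact: imset_f.
have wgt0 (x : 'rV[F]_n) : x != 0 -> (0 < hamming_weight x)%N.
  apply: contraNltn; rewrite leqn0 cards_eq0 => /eqP/setP x0.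
  apply/eqP/rowP => j; have := x0 j; rewrite !inE mxE => /negbT.
  by rewrite negbK => /eqP.
have weight_C x : (#|F| = 2%N -> 0 \in A) -> x \in C -> x != 0 ->
    (2 * h < hamming_weight x)%N.
  move=> F2 xC x0; rewrite -card_z; apply: (relation_weight UA) => //; first lia.
    by rewrite csum_z; apply/eqP; rewrite -mem_parity_check_code.
  by rewrite card_z wgt0.
have dimC : (\dim C + \dim (limg f) = n)%N.
  by have := limg_ker_dim f fullv; rewrite capfv dimvf /dim /= mul1n.
have dimf : (\dim (limg f) <= r)%N.
  by have := dimvS (subvf (limg f)); rewrite dimvf /dim /= muln1.
(* Here [\dim C >= n - r > 0], so a nonzero codeword exists. *)
have [|d dP] := @min_distance_exists _ _ C; first by rewrite -dimv_eq0; lia.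
exists (\dim C), d; split=> //.
- move=> F2; case: dP => [[x [xC x0 <-]] _].
  by rewrite addn1; apply: weight_C.
- split; first by lia.
  (* Outside the exceptional binary case [weight_C] applies, and the Singleton bound is used with
     [m = 2h]. *)
  have [/andP[/eqP F2 A0]|F2A] := boolP ((#|F| == 2%N) && (0 \notin A)); last first.
    have : (\dim C + 2 * h <= n)%N; last by lia.
    apply: singleton_bound => [|x xC]; first by lia.
    apply: contraTeq => x0; rewrite -ltnNge; apply: weight_C => // F2.
    by move: F2A; rewrite F2 /= negbK.
  (* The kernel of the coordinate sum meets [C] in the even-weight subcode [E]. *)
  pose g (x : 'rV[F]_n) : F^o := \sum_i x 0 i.
  have g_lin : linear g.
    move=> c x y; rewrite /g scaler_sumr -big_split; apply: eq_bigr => i _.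
    by rewrite !mxE.
  pose gL := GRing.isLinear.Build _ _ _ _ g g_lin.
  pose g' : {linear 'rV[F]_n -> F^o} := HB.pack g gL.
  pose E := (C :&: lker (linfun g'))%VS.
  have dimE : (\dim C <= (\dim E).+1)%N by apply: dim_cap_lker_form.
  (* Taking [m = 2h + 1] makes up for the dimension that may be lost in passing from [C] to [E]. *)
  have : (\dim E + (2 * h).+1 <= n)%N; last by lia.
  apply: singleton_bound => [|x]; first by lia.
  rewrite memv_cap memv_ker lfunE /= => /andP[xC /eqP gx].
  apply: contraTeq => x0; rewrite -ltnNge.
  have ev := binary_weight_even F2 gx.
  (* The weight is even, so exceeding [2h] already means exceeding [2h + 1]. *)
  have : ~~ (hamming_weight x <= 2 * h)%N; last by lia.
  apply/negP => le_xh.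
  pose k := (hamming_weight x)./2.
  have ck : hamming_weight x = (2 * k)%N by rewrite mul2n even_halfK.
  have Uk : unique_sums k A by apply: unique_sums_leq UA => //; lia.
  have zA : csupp (z x) \subset A by apply: subset_trans (supp_z x) (subsetDl _ _).
  have [y yz] : exists y, y \in csupp (z x) by apply/card_gt0P; rewrite card_z wgt0.
  have := subsetP (supp_z x) y yz; rewrite in_setD1 => /andP[y0 _].
  move: yz; apply/negP/csuppP; apply: (even_relation_trivial Uk) => //.
    by rewrite card_z.
  by rewrite csum_z; apply/eqP; rewrite -mem_parity_check_code.
(* A surjective [f] gives [\dim C = n - r]. Otherwise some [v] outside the image could be adjoined
   to [A], against maximality. *)
move=> [_ maxA]; suff : limg f = fullv.
  by move=> ff; move: dimC; rewrite ff dimvf /dim /= muln1; lia.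
apply/eqP; rewrite eqEsubv subvf /=; apply/subvP => v _.
apply: contraT => vf.
have AW : {subset A <= limg f}.
  move=> y yA; have [->|y0] := eqVneq y 0; first exact: mem0v.
  have : y \in A :\ 0 by rewrite in_setD1 y0.
  rewrite -HA => /imsetP[j _ ->]; apply/memv_imgP; exists (delta_mx 0 j).
    exact: memvf.
  by rewrite lfunE /= trmx_delta -colE.
have eA : A = v |: A.
  apply: maxA; last exact: subsetUr.
  apply: unique_sums_S_linear => //.
    by apply: leq_trans hA _; rewrite subset_leq_card // subsetUr.
  by apply: unique_sums_adjoin AW vf => //; lia.
by case/negP: vf; apply: AW; rewrite eA setU11.
Qed.
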